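(* For every $\varepsilon>0$ small enough, there is no deterministic comparison-based streaming algorithm that finds an $\varepsilon$-approximate median of the stream (an item whose rank $k'$ satisfies $|k'-N/2|\le\varepsilon N$, where $N$ is the stream length) and that stores $o\!\left(\frac{1}{\varepsilon}\log(\varepsilon N)\right)$ items on every input stream of length $N$.
   Context: Items come from a totally ordered universe $U$ which is unbounded and continuous: every non-empty open interval of $U$ contains arbitrarily many items. For a stream $\sigma$ of distinct items, the rank of an item $a$ is one plus the number of items of $\sigma$ strictly smaller than $a$. A deterministic streaming algorithm $\mathcal{D}$ is comparison-based if: (i) it performs no operation on stream items other than comparisons and equality tests; (ii) its memory is split into an item array $I$, storing only items that have already occurred in the stream (kept sorted), and a general memory $G$ containing no item identifiers; once an item is removed from $I$ it cannot be added back unless it appears again in the stream; (iii) on arrival of an item $a_i$, its computation is determined solely by the results of comparisons between $a_i$ and the entries of $I$, by $|I|$, and by $G$; (iv) its output is determined solely by $|I|$ and $G$, and it can only output an item stored in $I$. Space is measured as the number of items stored in $I$. *)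

(* Defs.v *)
From HB Require Import structures.
From mathcomp Require Import all_boot all_order all_algebra.
From mathcomp Require Import all_classical all_reals all_analysis.

Set Implicit Arguments.
Unset Strict Implicit.
Unset Printing Implicit Defensive.

Import Order.TTheory GRing.Theory Num.Theory.
Import numFieldNormedType.Exports.

Local Open Scope classical_set_scope.
Local Open Scope ring_scope.

Definition unbounded_continuous (d : Order.disp_t) (U : orderType d) : Prop :=
  [/\ inhabited U,
      forall x : U, (exists y : U, (y < x)%O) /\ (exists z : U, (x < z)%O)
    & forall x y : U, (x < y)%O -> forall n : nat, exists s : seq U,
        [/\ uniq s, size s = n & forall z, z \in s -> (x < z < y)%O] ].

(* Comparison-basedness is built into the types: the components of an
   algorithm never receive an item.
   - [step g cs], where [cs] lists the results of comparing the arriving item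
     with the entries of the item array (so [size cs] is the array's length),
     gives the new general memory and a list of positions describing the new
     item array: a position inside the array refers to the entry stored there,
     any other position refers to the arriving item.
   - [out g n] is the position, in an item array of length [n], of the item
     that is output. *)
Record cb_algorithm := CBAlgorithm {
  general_memory : Type;
  init : general_memory;
  step : general_memory -> seq (bool * bool) -> general_memory * seq nat;
  out : general_memory -> nat -> nat
}.

Section Execution.
Context (d : Order.disp_t) (U : orderType d).

Definition comparisons (a : U) (items : seq U) : seq (bool * bool) :=
  [seq ((a < x)%O, a == x) | x <- items].

Definition arrive (A : cb_algorithm) (m : general_memory A * seq U) (a : U) :
    general_memory A * seq U :=
  let: (g, items) := m in
  let: (g', js) := step g (comparisons a items) in
  (g', sort <=%O [seq nth a items j | j <- js]).

Definition run (A : cb_algorithm) (sigma : seq U) : general_memory A * seq U :=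
  foldl (@arrive A) (init A, [::]) sigma.

Definition output (A : cb_algorithm) (sigma : seq U) : option U :=
  let: (g, items) := run A sigma in onth items (out g (size items)).

(* The largest size of the item array at any time while reading [sigma]. *)
Definition items_stored (A : cb_algorithm) (sigma : seq U) : nat :=
  \max_(i < (size sigma).+1) size (run A (take i sigma)).2.

Definition item_rank (sigma : seq U) (a : U) : nat :=
  (count (fun x => (x < a)%O) sigma).+1.

Definition approx_median (R : realType) (eps : R) (sigma : seq U) (a : U) :
    Prop :=
  a \in sigma /\
  `|(item_rank sigma a)%:R - (size sigma)%:R / 2| <= eps * (size sigma)%:R.

(* A stream of odd length [N] has no [eps]-approximate median when
   [eps * N < 1/2] (e.g. [N = 1]), so nothing is required on such streams. *)
Definition finds_approx_median (R : realType) (A : cb_algorithm) (eps : R) :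
    Prop :=
  forall sigma : seq U, uniq sigma ->
    (exists a, approx_median eps sigma a) ->
    exists2 a, output A sigma = Some a & approx_median eps sigma a.

Definition stores_at_most (R : realType) (A : cb_algorithm) (s : nat -> R) :
    Prop :=
  forall sigma : seq U, uniq sigma ->
    (items_stored A sigma)%:R <= s (size sigma).

End Execution.

Definition space_bound (R : realType) (eps : R) (N : nat) : R :=
  1 / eps * ln (eps * N%:R).

(* Main.v *)
Require Import Defs.
From HB Require Import structures.
From mathcomp Require Import all_boot all_order all_algebra.
From mathcomp Require Import all_classical all_reals all_analysis.
From mathcomp Require Import zify ring lra.

Set Implicit Arguments.
Unset Strict Implicit.
Unset Printing Implicit Defensive.

Import Order.TTheory GRing.Theory Num.Theory.
Import numFieldNormedType.Exports.

(* An adversary feeds two streams in parallel, i.e. a stream of pairs, so that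
   the algorithm cannot tell them apart.  A cut z separates the stored pairs
   into those with p.1 <= z.1 and p.2 < z.2 and those with p.1 > z.1 and
   p.2 >= z.2; its gap is the number of second components below z.2 minus the
   number of first components up to z.1.  Appending items at one end moves any
   cut to the median without changing its gap, so gaps are O(eps N).

   To play n 2^(k+1) pairs in a pair of empty intervals, play n 2^k pairs there,
   take a cut z of maximal gap, and play n 2^k more pairs immediately above z.1
   in the first stream and immediately below z.2 in the second one.  Let g1 and
   g2 be the increases of the gap in the two phases, S1 and S2 the space used in
   them, and Q the number of pairs of the first phase retained until the end.
   The total increase g is at least g1 + g2, the space S satisfies S >= S1 and
   S >= S2 + Q, and n 2^k <= (Q + 2) (g + 1).  Averaging the two bounds on S and
   linearising the bound on Q in g shows, by induction on k,
     S >= k (31/512 n - 1) - (k n / 256) (g / 2^k).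
   For n about 1/eps we have g <= 8 * 2^k, and hence S = Omega(k / eps). *)

(** * Sequences over an ordered type *)

Lemma nth_map_default (S T : Type) (f : S -> T) (x : S) (s : seq S) (i : nat) :
  nth (f x) (map f s) i = f (nth x s i).
Proof. by elim: s i => [|y s IHs] [|i] //=. Qed.

Lemma notin_map_eqF (S T : eqType) (f : S -> T) (s : seq S) (x y : S) :
  f x \notin map f s -> y \in s -> (f x == f y) = false.
Proof. by move=> fx ys; apply: contraNF fx => /eqP->; apply: map_f. Qed.

Lemma sub_in_count (T : eqType) (a b : pred T) (s : seq T) :
  {in s, forall x, a x -> b x} -> count a s <= count b s.
Proof.
move=> ab; rewrite (@eq_in_count _ a (predI a b)); last first.
  by move=> x /ab; rewrite /=; case: (a x) => // ->.
by apply: sub_count => x /andP[].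
Qed.

Lemma exists_max_bounded (T : Type) (P : T -> Prop) (f : T -> int) (b : int) :
  (exists z, P z) -> (forall z, P z -> (f z <= b)%R) ->
  exists2 z, P z & forall z', P z' -> (f z' <= f z)%R.
Proof.
move=> [z0 Pz0] fb; pose Q n := `[< exists2 z, P z & f z = (f z0 + n%:Z)%R >].
have exQ : exists n, Q n by exists 0; apply/asboolP; exists z0; rewrite ?addr0.
have ubQ n : Q n -> n <= `|b - f z0|%N.
  by move=> /asboolP[z /fb fz e]; move: fz; rewrite e; clear; lia.
have [m /asboolP[z Pz fz] maxm] := ex_maxnP exQ ubQ; exists z => // z' Pz'.
rewrite leNgt; apply/negP => fz'; have := maxm `|f z' - f z0|%N.
suff -> : Q `|f z' - f z0|%N by move=> /(_ isT); move: fz fz'; clear; lia.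
by apply/asboolP; exists z' => //; move: fz fz'; clear; lia.
Qed.

Lemma has_argmin (d : Order.disp_t) (U : orderType d) (T : eqType)
    (f : T -> U) (a : pred T) (s : seq T) :
  has a s ->
  exists2 m, (m \in s) && a m & {in s, forall t, a t -> (f m <= f t)%O}.
Proof.
move=> /hasP[_ /seq_tnthP[i0 ->] ai0].
pose t := tnth (in_tuple s); case: (@arg_minP _ _ _ i0 (a \o t) (f \o t) ai0).
move=> i ai imin; exists (t i); first by rewrite mem_tnth.
by move=> _ /seq_tnthP[j ->]; apply: imin.
Qed.

Section OrderedSequences.
Context (d : Order.disp_t) (U : orderType d).
Implicit Types (s : seq U) (x y z l r : U).

Lemma exists_pair_lower_bound (unb : forall x, exists y, (y < x)%O) x0
    (s : seq (U * U)) :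
  exists l, {in s, forall p, (l < p.1)%O /\ (l < p.2)%O}.
Proof.
elim: s => [|p s [l ls]]; first by exists x0.
have [l' l'min] := unb (Order.min l (Order.min p.1 p.2)); exists l' => q.
move: l'min; rewrite !lt_min inE => /and3P[l'l l'p1 l'p2] /orP[/eqP-> // | /ls].
by case=> lq1 lq2; split; apply: lt_trans l'l _.
Qed.

Definition count_le s x : nat := count (<= x)%O s.
Definition count_lt s x : nat := count (< x)%O s.

Lemma leq_count_lt_le s x y : (x <= y)%O -> count_lt s x <= count_le s y.
Proof. by move=> xy; apply: sub_count => z /= /ltW/le_trans; apply. Qed.

Lemma leq_count_le_lt s x y : (x < y)%O -> count_le s x <= count_lt s y.
Proof. by move=> xy; apply: sub_count => z /= /le_lt_trans; apply. Qed.

Lemma ltn_count_lt_le s x y :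
  x \in s -> (x <= y)%O -> count_lt s x < count_le s y.
Proof.
move=> xs xy; rewrite /count_le (permP (perm_to_rem xs)) /= xy.
rewrite /count_lt (permP (perm_to_rem xs)) /= ltxx add0n.
exact: leq_count_lt_le.
Qed.

Lemma count_interval_leq s x y : uniq s -> (x <= y)%O ->
  count (fun z => x <= z <= y)%O s + count_le s x <= (count_le s y).+1.
Proof.
move=> us xy; apply: (@leq_trans (count_le s y + count_mem x s)).
  elim: s {us} => //= z s IHs; rewrite /count_le /= -!/(count_le _ _).
  rewrite addnACA [leqRHS]addnACA leq_add //.
  by case: (ltgtP x z) => [xz|zx|<-]; rewrite ?xy // (le_trans (ltW zx) xy).
by rewrite count_uniq_mem // -addn1 leq_add2l; case: (_ \in _).
Qed.

Lemma size_leq_windows s t (b : nat) :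
  {in t, forall z, has (<= z)%O s} ->
  {in s & t, forall x y, (x <= y)%O -> ~~ has (fun x' => x < x' <= y)%O s ->
     count (fun z => x <= z <= y)%O t <= b} ->
  size t <= size s * b.
Proof.
move=> s_le_t windows.
pose bucket x z := (x <= z)%O && ~~ has (fun x' => x < x' <= z)%O s.
have bucketed z : z \in t -> 0 < count (bucket^~ z) s.
  move=> /s_le_t sz; rewrite -has_count.
  have [m /andP[ms /= mz] mmax] := has_argmin (U := U^d) id sz.
  apply/hasP; exists m; rewrite // /bucket mz; apply/hasPn => x xs.
  by apply/negP => /andP[mx /(mmax x xs)]; rewrite leEdual leNgt mx.
apply: (@leq_trans (\sum_(x <- s) count (bucket x) t)).
  rewrite -sum1_size; under [leqRHS]eq_bigr do rewrite -sum1_count.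
  rewrite (exchange_big_dep predT) //= big_seq [leqRHS]big_seq.
  by apply: leq_sum => z zt; rewrite sum1_count bucketed.
rewrite mulnC -iter_addn_0 -(count_predT s) -big_const_seq.
rewrite big_seq [leqRHS]big_seq; apply: leq_sum => x xs.
have [tx|] := boolP (has (bucket x) t); last first.
  by rewrite has_count -leqNgt leqn0 => /eqP ->.
have [y /andP[yt /andP[xy noy]] ymax] := has_argmin (U := U^d) id tx.
apply: leq_trans (windows x y xs yt xy noy).
by apply: sub_in_count => z zt xz; have /andP[-> _] := xz; apply: (ymax z).
Qed.

Definition vacant s l r : Prop := {in s, forall z, (z <= l)%O || (r <= z)%O}.

Lemma count_le_vacant s l r x :
  vacant s l r -> (l <= x < r)%O -> count_le s x = count_le s l.
Proof.
move=> vac /andP[lx xr]; apply: eq_in_count => z /vac /= /orP[zl|rz].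
  by rewrite zl (le_trans zl lx).
by rewrite !leNgt (lt_le_trans xr rz) (lt_le_trans (le_lt_trans lx xr) rz).
Qed.

Lemma count_lt_vacant s l r x :
  vacant s l r -> (l < x <= r)%O -> count_lt s x = count_le s l.
Proof.
move=> vac /andP[lx xr]; apply: eq_in_count => z /vac /= /orP[zl|rz].
  by rewrite zl (le_lt_trans zl lx).
have xz := le_trans xr rz.
by rewrite [LHS]ltNge [RHS]leNgt xz (lt_le_trans lx xz).
Qed.

Lemma vacant_notin s l r x : vacant s l r -> (l < x < r)%O -> x \notin s.
Proof.
move=> vac /andP[lx xr]; apply/negP => /vac.
by rewrite leNgt lx leNgt xr.
Qed.

Lemma vacant_rcons s l r x :
  vacant s l r -> (l < x)%O -> vacant (rcons s x) x r.
Proof.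
move=> vac lx z; rewrite mem_rcons inE => /orP[/eqP->|/vac].
  by rewrite lexx.
by case/orP => [/le_trans->|->]; rewrite ?orbT // ltW.
Qed.

Lemma exists_vacant_right s x r : (x < r)%O ->
  exists r', [/\ (x < r')%O, (r' <= r)%O & vacant s x r'].
Proof.
move=> xr; pose t := r :: s.
have xt : has (> x)%O t by rewrite /= xr.
have [m /andP[_ /= xm] mmin] := has_argmin id xt; exists m; split=> //.
  by apply: mmin; rewrite ?mem_head.
by move=> z zs; case: leP => //= xz; apply: mmin; rewrite // inE zs orbT.
Qed.

End OrderedSequences.

Lemma exists_pair_upper_bound (d : Order.disp_t) (U : orderType d)
    (unb : forall x : U, exists y, (x < y)%O) (x0 : U) (s : seq (U * U)) :
  exists r, {in s, forall p, (p.1 < r)%O /\ (p.2 < r)%O}.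
Proof. exact: (@exists_pair_lower_bound _ U^d unb x0 s). Qed.

Lemma exists_vacant_left (d : Order.disp_t) (U : orderType d) (s : seq U)
    (l y : U) : (l < y)%O ->
  exists l', [/\ (l <= l')%O, (l' < y)%O & vacant s l' y].
Proof.
move=> ly; have [l' [l'y ll' vac]] := @exists_vacant_right _ U^d s y l ly.
by exists l'; split=> // z /vac; rewrite orbC.
Qed.

Definition densely_ordered (d : Order.disp_t) (U : orderType d) : Prop :=
  forall x y : U, (x < y)%O -> exists z, (x < z < y)%O.

Lemma unbounded_continuous_dense (d : Order.disp_t) (U : orderType d) :
  unbounded_continuous U -> densely_ordered U.
Proof.
move=> [_ _ den] x y /den/(_ 1)[[|z [|? ?]] [_ // _ hz]].
by exists z; apply: hz; rewrite mem_head.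
Qed.

(** * The space recurrence *)

Section SpaceGuarantee.
Local Open Scope ring_scope.
Context (R : realFieldType).

Definition space_guarantee (n k : nat) (g : R) : R :=
  k%:R * (31 / 512 * n%:R - 1) - k%:R * n%:R / 256 * (g / 2 ^+ k).

(* 1 / t is bounded from below by its tangent at t = 16. *)
Lemma tangent_le_inv (t : R) : 0 < t -> 1 / 8 - t / 256 <= t^-1.
Proof.
move=> t0; rewrite -[t^-1]mul1r (ler_pdivlMr _ _ t0).
by have := sqr_ge0 (t / 16 - 1); rewrite expr2; lra.
Qed.

Lemma retained_ge_linear (n P g Q : R) : 0 <= n -> 1 <= P -> 0 <= g ->
  n * P <= (Q + 2) * (g + 1) -> 31 / 256 * n - n / 256 * (g / P) <= Q + 2.
Proof.
move=> n0 P1 g0; have P0 : 0 < P by apply: lt_le_trans P1.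
pose t := (g + 1) / P.
have t0 : 0 < t by apply: divr_gt0 => //; apply: ltr_wpDl.
rewrite -ler_pdivlMr // -[leRHS]mulrA -/t -ler_pdivrMr //.
move/(le_trans _); apply.
apply: le_trans (ler_wpM2l n0 (tangent_le_inv t0)).
have tP : t <= g / P + 1 by rewrite /t mulrDl mul1r lerD2l invf_le1.
by have := ler_wpM2l n0 tP; lra.
Qed.

Lemma space_guarantee_step (n k g1 g2 g Q S1 S2 S : nat) :
  space_guarantee n k g1%:R <= S1%:R -> space_guarantee n k g2%:R <= S2%:R ->
  (g1 + g2 <= g)%N -> (n * 2 ^ k <= (Q + 2) * g.+1)%N ->
  (S1 <= S)%N -> (S2 + Q <= S)%N -> space_guarantee n k.+1 g%:R <= S%:R.
Proof.
rewrite -!(ler_nat R) !natrM (natrD R g1) (natrD R Q) (natrD R S2) -(natr1 g).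
rewrite natrX /space_guarantee exprS.
set P := 2 ^+ k => space1 space2 gg nP S1S S2S.
have P1 : 1 <= P by rewrite exprn_ege1 // ler1n.
have P0 : 0 < P by apply: lt_le_trans P1.
have Q_ge := retained_ge_linear (ler0n R n) P1 (ler0n R g) nP.
have gaps : k%:R * n%:R / 256 * (g1%:R / P + g2%:R / P) <=
    k%:R * n%:R / 256 * (g%:R / P) :> R.
  by rewrite -mulrDl ler_wpM2l ?mulr_ge0 ?invr_ge0 ?ler0n // ler_pM2r ?invr_gt0.
have -> : g%:R / (2 * P) = g%:R / P / 2 by rewrite invfM mulrCA mulrC.
rewrite -[k.+1%:R]natr1; move: space1 space2 Q_ge gaps.
set e1 := g1%:R / P; set e2 := g2%:R / P; set e := g%:R / P.
by lra.
Qed.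

Lemma space_guarantee_leq (n k S : nat) (g : R) : (100 <= n)%N ->
  g / 2 ^+ k <= 8 -> space_guarantee n k g <= S%:R -> (k * n <= 64 * S)%N.
Proof.
rewrite -!(ler_nat R) !natrM /space_guarantee => n_ge small_gap space.
have k_ge0 := ler0n R k; have kn_ge := ler_wpM2l k_ge0 n_ge.
have gap_cost : k%:R * n%:R / 256 * (g / 2 ^+ k) <= k%:R * n%:R / 256 * 8 :> R.
  by rewrite ler_wpM2l ?mulr_ge0 ?invr_ge0 ?ler0n.
by move: space gap_cost; set e := g / 2 ^+ k; lra.
Qed.

End SpaceGuarantee.

(** * Indistinguishable streams *)

Section TwinStreams.
Context (d : Order.disp_t) (U : orderType d) (A : cb_algorithm).
Implicit Types (tau delta : seq (U * U)) (p q l r z : U * U).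

(* A single run serves two streams at once: it reads pairs and decides by the
   first components, so it is a run on the second components as well as long
   as these compare in the same way with the stored items. *)
Definition paired_arrive (m : general_memory A * seq (U * U)) p :=
  let: (g, items) := m in
  let: (g', js) := step g (comparisons p.1 (unzip1 items)) in
  (g', sort (relpre fst <=%O) [seq nth p items j | j <- js]).

Definition paired_run tau := foldl paired_arrive (init A, [::]) tau.

Definition stored tau := (paired_run tau).2.

Lemma run_unzip1 tau :
  run A (unzip1 tau) = ((paired_run tau).1, unzip1 (stored tau)).
Proof.
elim/last_ind: tau => [|tau p] //.
rewrite /stored /paired_run /run /unzip1 map_rcons !foldl_rcons => ->.
case: (foldl _ _ tau) => g items /=.
case: (step _ _) => g' js /=; congr pair; rewrite -sort_map -map_comp.
by congr sort; apply: eq_map => j; rewrite /= nth_map_default.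
Qed.

Lemma mem_map_nth p (items : seq (U * U)) (js : seq nat) :
  {subset [seq nth p items j | j <- js] <= p :: items}.
Proof.
move=> q /mapP[j _ ->]; rewrite inE.
by case: (ltnP j (size items)) => hj;
  [rewrite mem_nth ?orbT | rewrite nth_default ?eqxx].
Qed.

Lemma stored_rcons tau p : {subset stored (rcons tau p) <= p :: stored tau}.
Proof.
rewrite /stored /paired_run foldl_rcons.
case: (foldl _ _ tau) => g items /=; case: (step _ _) => g' js /= q.
by rewrite mem_sort; apply: mem_map_nth.
Qed.

Lemma stored_cat tau delta q :
  q \in stored (tau ++ delta) -> q \in delta \/ q \in stored tau.
Proof.
elim/last_ind: delta => [|delta p IH]; first by rewrite cats0; right.
rewrite -rcons_cat mem_rcons => /stored_rcons; rewrite !inE.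
by move=> /orP[-> | /IH[->|]]; [left | left; rewrite orbT | right].
Qed.

Lemma mem_stored tau q : q \in stored tau -> q \in tau.
Proof. by move=> /(@stored_cat [::] tau)[]. Qed.

Definition concordant p q : Prop := (p.1 < q.1)%O = (p.2 < q.2)%O.

Definition coherent (M : seq (U * U)) : Prop :=
  {in M &, forall p q, concordant p q}.

Lemma coherent_cons (M : seq (U * U)) p : coherent M ->
  p.1 \notin unzip1 M -> p.2 \notin unzip2 M ->
  {in M, forall q, concordant p q} -> coherent (p :: M).
Proof.
move=> coh p1 p2 cp; have cp' : {in M, forall q, concordant q p}.
  move=> q qM; rewrite /concordant !ltNge !le_eqVlt cp //.
  by rewrite (notin_map_eqF p1) // (notin_map_eqF p2).
move=> q r; rewrite !inE => /orP[/eqP->|qM] /orP[/eqP->|rM].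
- by rewrite /concordant !ltxx.
- exact: cp.
- exact: cp'.
- exact: coh.
Qed.

Lemma sort_unzip2 (M : seq (U * U)) : coherent M ->
  sort <=%O (unzip2 M) = unzip2 (sort (relpre fst <=%O) M).
Proof.
move=> coh; apply: (sorted_eq le_trans le_anti).
- exact: (sort_sorted le_total).
- rewrite sorted_map (eq_in_sorted (P := mem M) (e' := relpre fst <=%O)).
  + by apply: sort_sorted => p q; apply: le_total.
  + by move=> p q pM qM; rewrite /= !leNgt coh.
  + by apply/allP => p; rewrite mem_sort.
- by rewrite perm_sort perm_sym; apply: perm_map; rewrite perm_sort.
Qed.

Definition twin tau : Prop :=
  [/\ uniq (unzip1 tau), uniq (unzip2 tau), coherent (stored tau)
    & run A (unzip2 tau) = ((paired_run tau).1, unzip2 (stored tau))].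

Lemma twin_nil : twin [::].
Proof. by []. Qed.

Lemma twin_uniq tau : twin tau -> uniq tau.
Proof. by case=> /map_uniq. Qed.

Lemma twin_rcons tau p : twin tau ->
  p.1 \notin unzip1 tau -> p.2 \notin unzip2 tau ->
  {in stored tau, forall q, concordant p q} -> twin (rcons tau p).
Proof.
move=> [u1 u2 coh run2] p1 p2 cp.
have p1s : p.1 \notin unzip1 (stored tau).
  by apply: contra p1 => /mapP[q /mem_stored qt ->]; apply: map_f.
have p2s : p.2 \notin unzip2 (stored tau).
  by apply: contra p2 => /mapP[q /mem_stored qt ->]; apply: map_f.
have cohp := coherent_cons coh p1s p2s cp.
have cmp : comparisons p.2 (unzip2 (stored tau)) =
           comparisons p.1 (unzip1 (stored tau)).
  rewrite /comparisons -!map_comp; apply/eq_in_map => q qs /=.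
  by rewrite cp // (notin_map_eqF p1s) // (notin_map_eqF p2s).
split.
- by rewrite /unzip1 map_rcons rcons_uniq p1.
- by rewrite /unzip2 map_rcons rcons_uniq p2.
- by move=> q r /stored_rcons qs /stored_rcons rs; apply: cohp.
move: run2 cmp cohp; rewrite /stored /paired_run /run /unzip2 map_rcons.
rewrite !foldl_rcons => ->; case: (foldl _ _ tau) => g items /= ->.
case: (step _ _) => g' js /= cohp; congr pair.
rewrite -/(unzip2 (sort _ _)) -sort_unzip2; last first.
  by move=> q r /mem_map_nth qp /mem_map_nth rp; apply: cohp.
rewrite /unzip2 -map_comp; congr sort.
by apply: eq_map => j; rewrite /= nth_map_default.
Qed.

(** * Cuts, gaps and plays *)

Definition same_side z p : Prop := (p.1 <= z.1)%O = (p.2 < z.2)%O.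

Definition is_cut tau z : Prop := {in stored tau, forall p, same_side z p}.

Definition gap tau z : int :=
  ((count_lt (unzip2 tau) z.2)%:Z - (count_le (unzip1 tau) z.1)%:Z)%R.

Definition rank_shift tau p : int :=
  ((count_lt (unzip2 tau) p.2)%:Z - (count_lt (unzip1 tau) p.1)%:Z)%R.

Lemma count_unzip_catB (a b : pred U) tau delta :
  {in delta, forall p, a p.1 = b p.2} ->
  ((count b (unzip2 (tau ++ delta)))%:Z - (count a (unzip1 (tau ++ delta)))%:Z =
   (count b (unzip2 tau))%:Z - (count a (unzip1 tau))%:Z)%R.
Proof.
move=> ab; rewrite /unzip1 /unzip2 !map_cat !count_cat !(count_map _ _ delta).
have -> : count (preim fst a) delta = count (preim snd b) delta.
  exact: eq_in_count.
by rewrite !PoszD opprD addrACA subrr addr0.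
Qed.

Lemma gap_cat tau delta z : {in delta, forall p, same_side z p} ->
  gap (tau ++ delta) z = gap tau z.
Proof. exact: count_unzip_catB. Qed.

Lemma rank_shift_cat tau delta p : {in delta, forall q, concordant q p} ->
  rank_shift (tau ++ delta) p = rank_shift tau p.
Proof. exact: (@count_unzip_catB (< p.1)%O (< p.2)%O). Qed.

Lemma is_cut_cat tau delta z : is_cut tau z ->
  {in delta, forall p, same_side z p} ->
  is_cut (tau ++ delta) z.
Proof. by move=> ct side p /stored_cat[/side|/ct]. Qed.

Definition inside l r p : bool := (l.1 < p.1 < r.1)%O && (l.2 < p.2 < r.2)%O.

Definition nested l r l' r' : Prop :=
  [/\ (l.1 <= l'.1)%O, (r'.1 <= r.1)%O, (l.2 <= l'.2)%O & (r'.2 <= r.2)%O].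

Lemma nested_left_corner l r p : inside l r p -> nested l r p r.
Proof. by move=> /andP[/andP[lp1 _] /andP[lp2 _]]; split=> //; apply: ltW. Qed.

Lemma sub_inside l r l' r' p :
  nested l r l' r' -> inside l' r' p -> inside l r p.
Proof.
move=> [l1 r1 l2 r2] /andP[/andP[lp1 pr1] /andP[lp2 pr2]]; rewrite /inside.
by rewrite (le_lt_trans l1 lp1) (lt_le_trans pr1 r1) (le_lt_trans l2 lp2)
  (lt_le_trans pr2 r2).
Qed.

Definition slot tau l r : Prop :=
  [/\ (l.1 < r.1)%O, (l.2 < r.2)%O, vacant (unzip1 tau) l.1 r.1,
      vacant (unzip2 tau) l.2 r.2 & is_cut tau (l.1, r.2)].

Lemma slot_stored tau l r q : slot tau l r -> q \in stored tau ->
  (q.1 <= l.1)%O && (q.2 <= l.2)%O || (r.1 <= q.1)%O && (r.2 <= q.2)%O.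
Proof.
move=> [lr1 lr2 v1 v2 ct] qs; have qt := mem_stored qs; have := ct q qs.
rewrite /same_side /=; case/orP: (v1 _ (map_f fst qt)) => [ql1|rq1].
  by rewrite ql1; case/orP: (v2 _ (map_f snd qt)) => [-> // | /le_gtF->].
rewrite leNgt (lt_le_trans lr1 rq1) => /esym/negbT.
by rewrite -leNgt => ->; rewrite rq1 orbT.
Qed.

Lemma slot_concordant tau l r p q : slot tau l r ->
  inside l r p -> q \in stored tau -> concordant p q /\ concordant q p.
Proof.
move=> sl /andP[/andP[lp1 pr1] /andP[lp2 pr2]]
  /(slot_stored sl)/orP[]/andP[q1 q2]; rewrite /concordant; split.
- by rewrite !ltNge (le_trans q1 (ltW lp1)) (le_trans q2 (ltW lp2)).
- by rewrite (le_lt_trans q1 lp1) (le_lt_trans q2 lp2).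
- by rewrite (lt_le_trans pr1 q1) (lt_le_trans pr2 q2).
- by rewrite !ltNge (le_trans (ltW pr1) q1) (le_trans (ltW pr2) q2).
Qed.

Lemma twin_insert tau l r p :
  twin tau -> slot tau l r -> inside l r p -> twin (rcons tau p).
Proof.
move=> tw sl ip; have [_ _ v1 v2 _] := sl; have /andP[ip1 ip2] := ip.
apply: twin_rcons => //.
- exact: vacant_notin v1 ip1.
- exact: vacant_notin v2 ip2.
by move=> q /(slot_concordant sl ip)[].
Qed.

Lemma slot_insert tau l r p :
  slot tau l r -> inside l r p -> slot (rcons tau p) p r.
Proof.
move=> sl /andP[/andP[lp1 pr1] /andP[lp2 pr2]]; have [_ _ v1 v2 ct] := sl.
split=> //.
- by rewrite /unzip1 map_rcons; apply: vacant_rcons v1 lp1.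
- by rewrite /unzip2 map_rcons; apply: vacant_rcons v2 lp2.
move=> q /stored_rcons; rewrite inE /same_side /= => /orP[/eqP-> | qs].
  by rewrite lexx pr2.
have /= <- := ct q qs; case/orP: (slot_stored sl qs) => /andP[q1 _].
  by rewrite q1 (le_trans q1 (ltW lp1)).
by rewrite !leNgt (lt_le_trans pr1 q1) (lt_le_trans (lt_trans lp1 pr1) q1).
Qed.

Lemma gap_slot_insert tau l r p : slot tau l r -> inside l r p ->
  gap (rcons tau p) (p.1, r.2) = gap tau (l.1, r.2).
Proof.
move=> [_ _ v1 _ _] /andP[/andP[lp1 pr1] /andP[_ pr2]].
rewrite -cats1 gap_cat => [|q]; last first.
  by rewrite inE /same_side => /eqP->; rewrite lexx pr2.
by rewrite /gap (count_le_vacant v1 (x := p.1)) // (ltW lp1).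
Qed.

Lemma rank_shift_slot tau l r p : slot tau l r ->
  (l.1 < p.1 <= r.1)%O -> (l.2 < p.2 <= r.2)%O ->
  rank_shift tau p = gap tau (l.1, r.2).
Proof.
move=> [_ lr2 v1 v2 _] p1 p2; rewrite /rank_shift /gap /=.
rewrite (count_lt_vacant v1 p1) (count_lt_vacant v2 p2).
by rewrite (count_lt_vacant v2 (x := r.2)) ?lr2 ?lexx.
Qed.

Definition play tau l r delta : Prop :=
  [/\ twin (tau ++ delta), all (inside l r) delta
    & {in stored (tau ++ delta), forall p, p \in delta ->
        (gap tau (l.1, r.2) <= rank_shift (tau ++ delta) p)%R}].

Definition cut_in tau l r z : Prop :=
  [/\ (l.1 <= z.1 < r.1)%O, (l.2 < z.2 <= r.2)%O & is_cut tau z].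

Definition max_cut tau l r z : Prop :=
  cut_in tau l r z /\
  forall z', cut_in tau l r z' -> (gap tau z' <= gap tau z)%R.

Definition gap_growth_le tau l r delta (g : nat) : Prop :=
  forall z, cut_in (tau ++ delta) l r z ->
    (gap (tau ++ delta) z <= gap tau (l.1, r.2) + g%:Z)%R.

Lemma cut_in_nested tau l r l' r' z :
  nested l r l' r' -> cut_in tau l' r' z -> cut_in tau l r z.
Proof.
move=> [l1 r1 l2 r2] [/andP[lz1 zr1] /andP[lz2 zr2] ct]; split=> //.
  by rewrite (le_trans l1 lz1) (lt_le_trans zr1 r1).
by rewrite (le_lt_trans l2 lz2) (le_trans zr2 r2).
Qed.

Lemma exists_max_cut tau l r z : cut_in tau l r z ->
  exists z' (g : nat), max_cut tau l r z' /\ gap tau z' = (gap tau z + g%:Z)%R.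
Proof.
move=> cz; have [|z' _|z' cz' maxz'] :=
  exists_max_bounded (P := cut_in tau l r) (f := gap tau) (b := (size tau)%:Z).
- by exists z.
- have := count_size (< z'.2)%O (unzip2 tau); rewrite size_map /gap /count_lt.
  by clear; lia.
exists z', `|gap tau z' - gap tau z|%N; split=> //.
by have := maxz' z cz; clear; lia.
Qed.

Lemma refine_slot tau l r z : cut_in tau l r z ->
  exists l' r', [/\ slot tau l' r', nested l r l' r' & (l'.1, r'.2) = z].
Proof.
case: z => x y [/= /andP[lx xr] /andP[ly yr] ct].
have [r1 [xr1 r1r v1]] := exists_vacant_right (unzip1 tau) xr.
have [l2 [ll2 l2y v2]] := exists_vacant_left (unzip2 tau) ly.
by exists (x, l2), (r1, y).
Qed.

Lemma play_cons tau l r p delta : twin tau -> slot tau l r -> inside l r p ->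
  play (rcons tau p) p r delta -> play tau l r (p :: delta).
Proof.
move=> tw sl ip [tw' ins shift]; have gapE := gap_slot_insert sl ip.
have /andP[/andP[lp1 pr1] /andP[lp2 pr2]] := ip.
move: tw' shift; rewrite cat_rcons gapE => tw' shift; split=> //=.
  rewrite ip; apply: sub_all ins => q.
  exact: sub_inside (nested_left_corner ip).
move=> q qs; rewrite inE => /orP[/eqP->|]; last exact: shift.
rewrite rank_shift_cat => [|q']; last first.
  rewrite inE /concordant => /orP[/eqP->|/(allP ins)]; first by rewrite !ltxx.
  by move=> /andP[/andP[/lt_gtF-> _] /andP[/lt_gtF-> _]].
by rewrite (rank_shift_slot sl) ?lp1 ?lp2 ?(ltW pr1) ?(ltW pr2).
Qed.

Lemma exists_play (dense : densely_ordered U) n tau l r :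
  twin tau -> slot tau l r -> exists delta z,
    [/\ size delta = n, play tau l r delta, cut_in (tau ++ delta) l r z
      & gap (tau ++ delta) z = gap tau (l.1, r.2)].
Proof.
elim: n tau l => [|n IHn] tau l tw sl; have [lr1 lr2 _ _ ct] := sl.
  exists [::], (l.1, r.2); rewrite /play /cut_in cats0 /=.
  by rewrite !lexx lr1 lr2.
have [a lar] := dense _ _ lr1; have [b lbr] := dense _ _ lr2.
have ip : inside l r (a, b) by rewrite /inside lar.
have [delta [z [szd pl cz gz]]] :=
  IHn _ _ (twin_insert tw sl ip) (slot_insert sl ip).
have pl' := play_cons tw sl ip pl.
move: (cut_in_nested (nested_left_corner ip) cz) gz.
rewrite cat_rcons (gap_slot_insert sl ip) => cz' gz.
by exists ((a, b) :: delta), z; rewrite /= szd.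
Qed.

Lemma play_cat tau l r delta l' r' delta' :
  play tau l r delta -> slot (tau ++ delta) l' r' -> nested l r l' r' ->
  (gap tau (l.1, r.2) <= gap (tau ++ delta) (l'.1, r'.2))%R ->
  play (tau ++ delta) l' r' delta' -> play tau l r (delta ++ delta').
Proof.
move=> [_ ins shift] sl' nest gap_le [tw' ins' shift']; rewrite /play catA.
split=> // [|p ps].
  by rewrite all_cat ins; apply: sub_all ins' => p; apply: sub_inside.
rewrite mem_cat orbC; have [pd' _|npd' /= pd] := boolP (p \in delta').
  exact: le_trans gap_le (shift' p ps pd').
have psd : p \in stored (tau ++ delta) by case/stored_cat: ps npd' => // ->.
rewrite rank_shift_cat; first exact: shift.
by move=> q /(allP ins') iq; have [] := slot_concordant sl' iq psd.
Qed.

Lemma is_cut_next tau x q : (x < q.1)%O ->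
  {in stored tau, forall p, concordant p q} ->
  {in stored tau, forall p, (x < p.1)%O -> (q.1 <= p.1)%O} ->
  is_cut tau (x, q.2).
Proof.
move=> xq conc next p ps; rewrite /same_side /= -conc //.
case: (leP p.1 x) => [/le_lt_trans-> // | /(next p ps) qp].
by rewrite ltNge qp.
Qed.

Lemma play_stored_concordant_corner tau l r delta : slot tau l r ->
  play tau l r delta -> {in stored (tau ++ delta), forall p, concordant p r}.
Proof.
move=> sl [_ ins _] p; have [lr1 lr2 _ _ _] := sl; rewrite /concordant.
case/stored_cat=> [/(allP ins)/andP[/andP[_ ->] /andP[_ ->]] //|].
case/(slot_stored sl)/orP=> /andP[p1 p2]; last by rewrite !ltNge p1 p2.
by rewrite (le_lt_trans p1 lr1) (le_lt_trans p2 lr2).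
Qed.

Lemma rank_shift_corner tau l r delta : slot tau l r -> play tau l r delta ->
  rank_shift (tau ++ delta) r = gap tau (l.1, r.2).
Proof.
move=> sl [_ ins _]; have [lr1 lr2 _ _ _] := sl.
rewrite rank_shift_cat; first by rewrite (rank_shift_slot sl) ?lr1 ?lr2 ?lexx.
by move=> p /(allP ins)/andP[/andP[_ p1] /andP[_ p2]];
  rewrite /concordant p1 p2.
Qed.

Definition retained sigma delta : seq (U * U) :=
  [seq p <- delta | p \in stored sigma].

(* The next stored pair after x, or the corner r of the box if there is none,
   yields a cut at x whose gap is at least the rank shift of that pair plus the
   number of items of the first stream in the window. *)
Lemma count_le_unstored_window tau l r delta (g : nat) x w :
  let sigma := tau ++ delta in
  slot tau l r -> play tau l r delta -> gap_growth_le tau l r delta g ->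
  (l.1 <= x < r.1)%O -> (w < r.1)%O ->
  {in stored sigma, forall q, ~~ (x < q.1 <= w)%O} ->
  count_le (unzip1 sigma) w <= count_le (unzip1 sigma) x + g.
Proof.
move=> sigma sl pl growth /andP[lx xr] wr unstored.
have [[_ _ coh _] ins shift] := pl; have [_ lr2 _ _ _] := sl.
pose candidates := r :: retained sigma delta.
have some : has (fun p => x < p.1)%O candidates by rewrite /= xr.
have [q /andP[qc xq] qmin] := has_argmin fst some.
have [q2 wq conc_q shift_q] : [/\ (l.2 < q.2 <= r.2)%O, (w < q.1)%O,
    {in stored sigma, forall p, concordant p q}
    & (gap tau (l.1, r.2) <= rank_shift sigma q)%R].
  move: qc; rewrite inE mem_filter => /orP[/eqP-> | /andP[qs qd]].
    rewrite lr2 lexx (rank_shift_corner sl pl).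
    by split=> //; apply: play_stored_concordant_corner sl pl.
  have /andP[_ /andP[lq2 /ltW qr2]] := allP ins q qd.
  split; [by rewrite lq2 | | by move=> p ps; apply: coh | exact: shift].
  by move: (unstored q qs); rewrite xq -ltNge.
have cz : cut_in sigma l r (x, q.2).
  split=> //=; first by rewrite lx.
  apply: is_cut_next => // p ps xp.
  case/stored_cat: (ps) => [pd | /(slot_stored sl)/orP[]/andP[p1 _]].
  - by apply: qmin; rewrite // inE mem_filter ps pd orbT.
  - by move: (lt_le_trans xp p1); rewrite ltNge lx.
  - by apply: le_trans p1; apply: qmin; rewrite ?mem_head.
have := growth _ cz; have := leq_count_le_lt (unzip1 sigma) wq.
by move: shift_q; rewrite -/sigma /gap /rank_shift /=; clear; lia.
Qed.

Definition peak tau delta : nat :=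
  \max_(j < (size delta).+1) size (retained (tau ++ take j delta) delta).

Lemma size_retained_cat sigma delta delta' : uniq (delta ++ delta') ->
  size (retained (sigma ++ delta') delta) <= size (retained sigma delta).
Proof.
rewrite cat_uniq !size_filter => /and3P[_ /hasPn disj _].
apply: sub_in_count => p pd /= /stored_cat[pd'|//].
by move: (disj p pd'); rewrite /= pd.
Qed.

Lemma size_retained_leq_peak tau delta j : j <= size delta ->
  size (retained (tau ++ take j delta) delta) <= peak tau delta.
Proof.
rewrite -ltnS => jd.
exact: (leq_bigmax
  (F := fun i : 'I__ => size (retained (tau ++ take i delta) delta))
  (Ordinal jd)).
Qed.

Lemma exists_peak tau delta : exists2 j, j <= size delta &
  peak tau delta = size (retained (tau ++ take j delta) delta).
Proof.
rewrite /peak; have [|j ->] := bigop.eq_bigmax (fun j : 'I_(size delta).+1 =>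
  size (retained (tau ++ take j delta) delta)); first by rewrite card_ord.
by exists j => //; rewrite -ltnS.
Qed.

Lemma peak_prefix tau delta delta' :
  peak tau delta <= peak tau (delta ++ delta').
Proof.
have [j jd ->] := exists_peak tau delta.
apply: leq_trans (size_retained_leq_peak _ (j := j) _); last first.
  by rewrite size_cat (leq_trans jd) // leq_addr.
by rewrite takel_cat // /retained filter_cat size_cat leq_addr.
Qed.

Lemma peak_suffix tau delta delta' : uniq (delta ++ delta') ->
  peak (tau ++ delta) delta' + size (retained (tau ++ delta ++ delta') delta) <=
  peak tau (delta ++ delta').
Proof.
move=> uniq_deltas; have [j jd ->] := exists_peak (tau ++ delta) delta'.
apply: leq_trans (size_retained_leq_peak _ (j := size delta + j) _); last first.
  by rewrite size_cat leq_add2l.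
rewrite take_cat ltnNge leq_addr /= addKn /retained filter_cat size_cat addnC.
rewrite !catA leq_add2r -[in leqLHS](cat_take_drop j delta') catA.
apply: size_retained_cat; apply: subseq_uniq uniq_deltas.
by apply: cat_subseq => //; apply: drop_subseq.
Qed.

Lemma peak_leq_items_stored delta : uniq delta ->
  peak [::] delta <= items_stored A (unzip1 delta).
Proof.
move=> uniq_delta; have [j jd ->] := exists_peak [::] delta.
apply: (@leq_trans (size (stored (take j delta)))).
  apply: uniq_leq_size; first by rewrite filter_uniq.
  by move=> p; rewrite mem_filter => /andP[].
rewrite -(size_map fst) -[map _ _]/(((paired_run (take j delta)).1, _).2).
rewrite -run_unzip1 [unzip1 _]map_take.
have js : j < (size (unzip1 delta)).+1 by rewrite size_map ltnS.
exact: (leq_bigmax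
  (F := fun i : 'I__ => size (run A (take i _)).2) (Ordinal js)).
Qed.

Definition landmarks sigma l r delta : seq U :=
  [:: l.1, r.1 & unzip1 (retained sigma delta)].

(* The second phase was played between l'.1 and r'.1, so it only affects the
   window containing this interval, which the landmark r'.1 splits in two. *)
Lemma no_stored_between_landmarks tau l r delta l' r' delta' x w :
  let sigma := tau ++ delta ++ delta' in
  slot tau l r -> all (inside l r) delta ->
  slot (tau ++ delta) l' r' -> all (inside l' r') delta' ->
  (l.1 <= x)%O -> w \in unzip1 delta ->
  ~~ has (fun y => x < y <= w)%O (landmarks sigma l r' delta) ->
  {in stored sigma, forall q, ~~ (x < q.1 <= w)%O}.
Proof.
move=> sigma sl ins [_ _ v1 _ _] ins' lx wd /hasPn none q qs.
apply/negP => /andP[xq qw].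
have wr : (w < r.1)%O by case/mapP: wd => p /(allP ins)/andP[/andP[_ pr] _] ->.
case/stored_cat: (qs) => [|/(slot_stored sl)/orP[]/andP[q1 _]]; last first.
- by move: (le_lt_trans (le_trans q1 qw) wr); rewrite ltxx.
- by move: (lt_le_trans xq (le_trans q1 lx)); rewrite ltxx.
rewrite mem_cat => /orP[qd|/(allP ins')/andP[/andP[lq qr] _]].
  have : q.1 \in landmarks sigma l r' delta.
    by rewrite !inE map_f ?orbT // mem_filter qs.
  by move/none; rewrite xq qw.
have /v1/orP[wl|rw] : w \in unzip1 (tau ++ delta).
- by rewrite /unzip1 map_cat mem_cat wd orbT.
- by move: (lt_le_trans lq (le_trans qw wl)); rewrite ltxx.
have : r'.1 \in landmarks sigma l r' delta by rewrite !inE eqxx orbT.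
by move/none; rewrite rw (lt_trans xq qr).
Qed.

Lemma size_leq_retained tau l r delta l' r' delta' (g : nat) :
  slot tau l r -> play tau l r (delta ++ delta') ->
  slot (tau ++ delta) l' r' -> all (inside l' r') delta' -> (l.1 <= r'.1)%O ->
  gap_growth_le tau l r (delta ++ delta') g ->
  size delta <= (size (retained (tau ++ delta ++ delta') delta) + 2) * g.+1.
Proof.
set sigma := tau ++ delta ++ delta' => sl pl sl' ins' lr' growth.
have [[u1 _ _ _] + _] := pl; rewrite all_cat => /andP[ins _].
have -> : size (retained sigma delta) + 2 = size (landmarks sigma l r' delta).
  by rewrite /= size_map addn2.
have l_le x : x \in landmarks sigma l r' delta -> (l.1 <= x)%O.
  rewrite !inE => /or3P[/eqP-> //|/eqP-> //|/mapP[p]].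
  by rewrite mem_filter => /andP[_ /(allP ins)/andP[/andP[/ltW ? _] _]] ->.
have lwr w : w \in unzip1 delta -> (l.1 < w < r.1)%O.
  by case/mapP => p /(allP ins)/andP[lpr _] ->.
rewrite -(size_map fst delta).
apply: size_leq_windows => [w /lwr/andP[/ltW lw _]|x w xs wd xw none].
  by rewrite /= lw.
have /andP[lw wr] := lwr w wd.
have xr : (l.1 <= x < r.1)%O by rewrite l_le // (le_lt_trans xw wr).
have unstored :=
  no_stored_between_landmarks sl ins sl' ins' (l_le x xs) wd none.
have window := count_le_unstored_window sl pl growth xr wr unstored.
apply: (@leq_trans (count (fun y => x <= y <= w)%O (unzip1 sigma))).
  by rewrite /unzip1 !map_cat !count_cat addnCA leq_addr.
rewrite -(leq_add2r (count_le (unzip1 sigma) x)).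
by apply: leq_trans (count_interval_leq u1 xw) _; rewrite addSn ltnS addnC.
Qed.

Lemma exists_adversarial_play (R : realFieldType) (dense : densely_ordered U)
    n k tau l r :
  twin tau -> slot tau l r -> exists delta z (g : nat),
    [/\ size delta = n * 2 ^ k, play tau l r delta,
        max_cut (tau ++ delta) l r z,
        gap (tau ++ delta) z = (gap tau (l.1, r.2) + g%:Z)%R
      & (space_guarantee n k g%:R <= (peak tau delta)%:R :> R)%R].
Proof.
elim: k tau l r => [|k IHk] tau l r tw sl.
  have [delta [z0 [szd pl cz gz0]]] := exists_play dense n tw sl.
  have [z [g [mz gz]]] := exists_max_cut cz.
  exists delta, z, g; split; rewrite ?gz ?gz0 ?muln1 //.
  by rewrite /space_guarantee !mul0r subr0.
have [d1 [z1 [g1 [sz1 pl1 [cz1 _] gz1 space1]]]] := IHk _ _ _ tw sl.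
have [l' [r' [sl' nest z1E]]] := refine_slot cz1; have [tw1 _ _] := pl1.
have [d2 [z2 [g2 [sz2 pl2 [cz2 _] gz2 space2]]]] := IHk _ _ _ tw1 sl'.
have [z [g3 [mz gz3]]] := exists_max_cut (cut_in_nested nest cz2).
have pl : play tau l r (d1 ++ d2).
  by apply: play_cat pl1 sl' nest _ pl2; rewrite z1E gz1 lerDl.
have gz : gap (tau ++ d1 ++ d2) z =
    (gap tau (l.1, r.2) + (g1 + g2 + g3)%N%:Z)%R.
  by rewrite catA gz3 gz2 z1E gz1 !PoszD !addrA.
have uniq_ds : uniq (d1 ++ d2).
  by case: pl => /twin_uniq; rewrite cat_uniq => /and3P[].
exists (d1 ++ d2), z, (g1 + g2 + g3); split=> //.
- by rewrite size_cat sz1 sz2 -mulnDr addnn -mul2n expnS.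
- by rewrite catA.
have few : size d1 <=
    (size (retained (tau ++ d1 ++ d2) d1) + 2) * (g1 + g2 + g3).+1.
  have [lr' _ _ _ _] := sl'; have [ll' _ _ _] := nest; have [_ ins2 _] := pl2.
  apply: size_leq_retained sl pl sl' ins2 (le_trans ll' (ltW lr')) _ => z'.
  by rewrite -gz catA; apply: mz.2.
apply: (space_guarantee_step space1 space2 _ _ (peak_prefix _ _ _)
  (peak_suffix _ uniq_ds)); first by rewrite leq_addr.
by rewrite -sz1.
Qed.

(** * Centring a cut *)

Definition below z p : bool := (p.1 <= z.1)%O && (p.2 < z.2)%O.
Definition above z p : bool := (z.1 < p.1)%O && (z.2 <= p.2)%O.

Definition num_below tau z : nat :=
  count_le (unzip1 tau) z.1 + count_lt (unzip2 tau) z.2.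

Lemma below_same_side z p : below z p -> same_side z p.
Proof. by rewrite /same_side => /andP[-> ->]. Qed.

Lemma above_same_side z p : above z p -> same_side z p.
Proof. by rewrite /same_side [LHS]leNgt [RHS]ltNge => /andP[-> ->]. Qed.

Lemma num_below_cat tau delta z :
  num_below (tau ++ delta) z = num_below tau z + num_below delta z.
Proof.
rewrite /num_below /count_le /count_lt /unzip1 /unzip2 !map_cat !count_cat.
exact: addnACA.
Qed.

Lemma num_below_all_below delta z :
  all (below z) delta -> num_below delta z = (size delta).*2.
Proof.
move=> /allP lo; rewrite /num_below -addnn /count_le /count_lt !count_map.
by congr addn; apply/eqP; rewrite -all_count; apply/allP => p /lo /andP[].
Qed.

Lemma num_below_all_above delta z :
  all (above z) delta -> num_below delta z = 0.
Proof.
move=> /allP hi; rewrite /num_below /count_le /count_lt !count_map.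
rewrite -[RHS](addn0 0); congr addn; apply/eqP; rewrite eqn0Ngt -has_count.
  by apply/hasPn => p /hi /andP[zp1 _]; rewrite /= -ltNge.
by apply/hasPn => p /hi /andP[_ zp2]; rewrite /= -leNgt.
Qed.

Lemma exists_play_below (hU : unbounded_continuous U) n tau z : twin tau ->
  exists delta, [/\ size delta = n, twin (tau ++ delta) & all (below z) delta].
Proof.
have [_ unb _] := hU => tw.
have [b b_lt] := exists_pair_lower_bound (fun x => (unb x).1) z.1 (z :: tau).
have [[a ab] _] := unb b.
have b_lt_tau p : p \in tau -> (b < p.1)%O /\ (b < p.2)%O.
  by move=> pt; apply: b_lt; rewrite inE pt orbT.
have sl : slot tau (a, a) (b, b).
  split=> // [_ /mapP[p pt ->]|_ /mapP[p pt ->]|p /mem_stored pt] /=.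
  - by have [/ltW-> _] := b_lt_tau p pt; rewrite orbT.
  - by have [_ /ltW->] := b_lt_tau p pt; rewrite orbT.
  have [bp1 bp2] := b_lt_tau p pt.
  by apply: above_same_side; rewrite /above (lt_trans ab bp1) (ltW bp2).
have [delta [_ [szd [tw' ins _] _ _]]] :=
  exists_play (unbounded_continuous_dense hU) n tw sl.
exists delta; split=> //.
apply: sub_all ins => p /andP[/andP[_ pb1] /andP[_ pb2]].
have [bz1 bz2] := b_lt z (mem_head _ _).
by rewrite /below (ltW (lt_trans pb1 bz1)) (lt_trans pb2 bz2).
Qed.

Lemma exists_play_above (hU : unbounded_continuous U) n tau z : twin tau ->
  exists delta, [/\ size delta = n, twin (tau ++ delta) & all (above z) delta].
Proof.
have [_ unb _] := hU => tw.
have [a a_gt] := exists_pair_upper_bound (fun x => (unb x).2) z.1 (z :: tau).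
have [_ [b ab]] := unb a.
have a_gt_tau p : p \in tau -> (p.1 < a)%O /\ (p.2 < a)%O.
  by move=> pt; apply: a_gt; rewrite inE pt orbT.
have sl : slot tau (a, a) (b, b).
  split=> // [_ /mapP[p pt ->]|_ /mapP[p pt ->]|p /mem_stored pt] /=.
  - by have [/ltW-> _] := a_gt_tau p pt.
  - by have [_ /ltW->] := a_gt_tau p pt.
  have [pa1 pa2] := a_gt_tau p pt.
  by apply: below_same_side; rewrite /below (ltW pa1) (lt_trans pa2 ab).
have [delta [_ [szd [tw' ins _] _ _]]] :=
  exists_play (unbounded_continuous_dense hU) n tw sl.
exists delta; split=> //.
apply: sub_all ins => p /andP[/andP[ap1 _] /andP[ap2 _]].
have [za1 za2] := a_gt z (mem_head _ _).
by rewrite /above (lt_trans za1 ap1) (ltW (lt_trans za2 ap2)).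
Qed.

Definition centred tau z : Prop := size tau = num_below tau z.

Lemma exists_centring (hU : unbounded_continuous U) tau z : twin tau ->
  exists delta, [/\ twin (tau ++ delta), {in delta, forall p, same_side z p},
    size delta <= size tau & centred (tau ++ delta) z].
Proof.
rewrite /centred => tw; have [low|high] := leqP (num_below tau z) (size tau).
  have [delta [szd tw' lo]] :=
    exists_play_below hU (size tau - num_below tau z) z tw.
  exists delta; split=> [//|p /(allP lo)/below_same_side //| |].
    by rewrite szd leq_subr.
  rewrite num_below_cat (num_below_all_below lo) size_cat szd.
  by rewrite -addnn addnA subnKC.
have [delta [szd tw' hi]] :=
  exists_play_above hU (num_below tau z - size tau) z tw.
exists delta; split=> [//|p /(allP hi)/above_same_side //| |].
  rewrite szd leq_subLR; apply: leq_add.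
    by rewrite -(size_map fst) count_size.
  by rewrite -(size_map snd) count_size.
rewrite num_below_cat (num_below_all_above hi) size_cat szd addn0.
by rewrite subnKC // ltnW.
Qed.

End TwinStreams.

(** * The lower bound *)

Section CostlyStreams.
Local Open Scope ring_scope.
Context (R : realType) (d : Order.disp_t) (U : orderType d).

Lemma exists_approx_median (eps : R) (sigma : seq U) : uniq sigma ->
  1 <= eps * (size sigma)%:R -> exists a, approx_median eps sigma a.
Proof.
case: sigma => [|x s] us; first by rewrite mulr0 ler10.
set sigma := x :: s => large; set i := (size sigma)./2.
have isz : (i < size (sort <=%O%O sigma))%N.
  by rewrite size_sort ltn_half_double -addnn -[ltnLHS]addn0 ltn_add2l.
exists (nth x (sort <=%O%O sigma) i); split.
  by rewrite -(mem_sort <=%O%O) mem_nth.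
have srt : sorted <%O%O (sort <=%O%O sigma) by rewrite sort_lt_sorted.
apply: le_trans large; rewrite /item_rank.
rewrite -(count_sort <=%O%O) (count_lt_nth x srt isz).
have -> : (size sigma)%:R = (odd (size sigma))%:R + 2 * i%:R :> R.
  by rewrite -natrM -natrD -[in LHS](odd_double_half (size sigma)) -mul2n.
by case: odd => /=; rewrite ler_norml -natr1; lra.
Qed.

Context (hU : unbounded_continuous U) (A : cb_algorithm) (eps : R).
Hypotheses (eps_gt0 : 0 < eps) (finds : finds_approx_median U A eps).

Lemma twin_output (sigma : seq (U * U)) : twin A sigma ->
  1 <= eps * (size sigma)%:R ->
  exists p, [/\ p \in stored A sigma, approx_median eps (unzip1 sigma) p.1
    & approx_median eps (unzip2 sigma) p.2].
Proof.
move=> [u1 u2 _ run2] large.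
have [|a1] := finds u1; first by apply: exists_approx_median; rewrite ?size_map.
have [|a2] := finds u2; first by apply: exists_approx_median; rewrite ?size_map.
rewrite /output run2 run_unzip1 !size_map !onth_map.
case E : (onth _ _) => [p|] //= [<-] med2 [<-] med1.
by exists p; split=> //; apply/onthP; eexists; exact: E.
Qed.

Lemma centred_cut_gap_le (sigma : seq (U * U)) z :
  twin A sigma -> is_cut A sigma z -> centred sigma z ->
  1 <= eps * (size sigma)%:R -> (gap sigma z)%:~R <= 2 * eps * (size sigma)%:R.
Proof.
move=> tw ct szE large; have [p [ps [_ +] [_ +]]] := twin_output tw large.
rewrite /item_rank -!/(count_lt _ _) !size_map !ler_norml.
move=> /andP[med1 _] /andP[_ med2].
rewrite /gap rmorphB /= -!pmulrn; have := ct p ps; rewrite /same_side.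
have sizeE : (size sigma)%:R = (count_le (unzip1 sigma) z.1)%:R +
    (count_lt (unzip2 sigma) z.2)%:R :> R by rewrite szE natrD.
case: (leP p.1 z.1) => pz1; case: (ltP p.2 z.2) => // pz2 _.
  have : (count_lt (unzip1 sigma) p.1 < count_le (unzip1 sigma) z.1)%N.
    by rewrite ltn_count_lt_le ?(map_f fst (mem_stored ps)).
  by rewrite -(ler_nat R); move: med1; rewrite sizeE; lra.
have : (count_lt (unzip2 sigma) z.2 <= count_lt (unzip2 sigma) p.2)%N.
  by apply: sub_count => x /= /lt_le_trans; apply.
by rewrite -(ler_nat R); move: med2; rewrite -natr1 sizeE; lra.
Qed.

Lemma cut_gap_le (tau : seq (U * U)) z : twin A tau -> is_cut A tau z ->
  1 <= eps * (size tau)%:R -> (gap tau z)%:~R <= 4 * eps * (size tau)%:R.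
Proof.
move=> tw ct large; have [delta [tw' side szd mid]] := exists_centring hU z tw.
rewrite -(gap_cat _ side).
have sz_ge : (size tau)%:R <= (size (tau ++ delta))%:R :> R.
  by rewrite ler_nat size_cat leq_addr.
have sz_le : (size (tau ++ delta))%:R <= 2 * (size tau)%:R :> R.
  by rewrite -natrM ler_nat size_cat mul2n -addnn leq_add2l.
have large' : 1 <= eps * (size (tau ++ delta))%:R.
  by apply: le_trans large _; rewrite ler_pM2l.
apply: le_trans (centred_cut_gap_le tw' (is_cut_cat ct side) mid large') _.
have -> : 4 * eps * (size tau)%:R = 2 * eps * (2 * (size tau)%:R) by ring.
by rewrite ler_pM2l // mulr_gt0.
Qed.

Lemma exists_costly_stream (n k : nat) :
  1 <= eps * n%:R -> eps * n%:R <= 2 -> (100 <= n)%N ->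
  exists sigma : seq U, [/\ uniq sigma, size sigma = (n * 2 ^ k)%N
    & (k * n <= 64 * items_stored A sigma)%N].
Proof.
move=> en1 en2 n100; have [[x] unb _] := hU; have [_ [y xy]] := unb x.
have sl : slot A [::] (x, x) (y, y) by [].
have [delta [z [g [szd [tw _ _] [[_ _ ct] _] /= gz space]]]] :=
  exists_adversarial_play R (unbounded_continuous_dense hU) n k
    (twin_nil U A) sl.
have pow_ge1 : 1 <= 2 ^+ k :> R by rewrite exprn_ege1 // ler1n.
have sizeE : eps * (size delta)%:R = eps * n%:R * 2 ^+ k.
  by rewrite szd natrM natrX mulrA.
have small_gap : g%:R / 2 ^+ k <= 8 :> R.
  rewrite ler_pdivrMr ?(lt_le_trans ltr01) //.
  have := cut_gap_le tw ct; rewrite gz -mulrA sizeE.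
  move=> /(_ (mulr_ege1 en1 pow_ge1)) /le_trans; apply.
  by rewrite mulrA ler_wpM2r ?(le_trans ler01) //; lra.
exists (unzip1 delta); split; [by case: tw | by rewrite size_map |].
apply: leq_trans (space_guarantee_leq n100 small_gap space) _.
by rewrite leq_mul2l peak_leq_items_stored ?(twin_uniq tw).
Qed.

End CostlyStreams.

Section SpaceBound.
Local Open Scope classical_set_scope.
Local Open Scope ring_scope.
Context (R : realType) (eps : R).
Hypothesis eps_gt0 : 0 < eps.

Lemma exists_nat_ceil_inv : exists n : nat, 1 <= eps * n%:R <= 1 + eps.
Proof.
have inv_ge0 : 0 <= eps^-1 by rewrite invr_ge0 ltW.
have /andP[trunc_le lt_trunc] := truncn_itv inv_ge0.
have epsK : eps * eps^-1 = 1 by rewrite divff // gt_eqF.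
exists (Num.truncn eps^-1).+1; apply/andP; split.
  by rewrite -[leLHS]epsK ler_pM2l // ltW.
by rewrite -natr1 mulrDr mulr1 lerD2r -[leRHS]epsK ler_pM2l.
Qed.

Lemma space_bound_le (n k : nat) : (0 < k)%N ->
  1 <= eps * n%:R -> eps * n%:R <= 2 ->
  space_bound eps (n * 2 ^ k) <= 2 * (k%:R * n%:R).
Proof.
move=> k_gt0 en1 en2; rewrite /space_bound natrM natrX mulrA.
have en_gt0 : 0 < eps * n%:R by apply: lt_le_trans en1.
have inv_le : 1 / eps <= n%:R by rewrite ler_pdivrMr // mulrC.
have ln2_le1 : ln (2 : R) <= 1.
  by have := @le_ln1Dx R 1; rewrite -natr1; apply; lra.
have ln_le : ln (eps * n%:R * 2 ^+ k) <= 2 * k%:R.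
  apply: (@le_trans _ _ (ln (2 ^+ k.+1))).
    rewrite ler_ln ?posrE ?(mulr_gt0 en_gt0) ?exprn_gt0 //.
    by rewrite exprS ler_wpM2r ?exprn_ge0.
  rewrite lnXn // -[leLHS]mulr_natr; apply: (@le_trans _ _ (1 * k.+1%:R)).
    by rewrite ler_wpM2r.
  have k_ge1 : 1 <= k%:R :> R by rewrite ler1n.
  by rewrite mul1r -natr1; lra.
have -> : 2 * (k%:R * n%:R) = n%:R * (2 * k%:R) :> R by ring.
apply: (@le_trans _ _ (1 / eps * (2 * k%:R))).
  by rewrite ler_pM2l // div1r invr_gt0.
by rewrite ler_wpM2r ?mulr_ge0.
Qed.

Lemma eventually_le_space_bound (s : nat -> R) (c : R) : 0 < c ->
  s =o_\oo (space_bound eps) ->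
  \forall N \near \oo, s N <= c * space_bound eps N.
Proof.
move=> c_gt0 /eqoP/(_ c c_gt0) small; near=> N.
have eN : 1 <= eps * N%:R.
  rewrite mulrC -ler_pdivrMr //; near: N; exact: nbhs_infty_ger.
have bound_ge0 : 0 <= space_bound eps N.
  by rewrite /space_bound mulr_ge0 ?ln_ge0 // div1r invr_ge0 ltW.
apply: le_trans (ler_norm _) _; rewrite -(ger0_norm bound_ge0).
by near: N.
Unshelve. all: by end_near. Qed.

Lemma not_eventually_le_space_bound (d : Order.disp_t) (U : orderType d)
    (A : cb_algorithm) (s : nat -> R) :
  unbounded_continuous U -> eps < 1 / 100 ->
  finds_approx_median U A eps -> stores_at_most U A s ->
  ~ \forall N \near \oo, s N <= 1 / 200 * space_bound eps N.
Proof.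
move=> hU eps_small finds stores [N0 _ small].
have [n /andP[en1 en_le]] := exists_nat_ceil_inv.
have en2 : eps * n%:R <= 2 by lra.
have n100 : (100 <= n)%N by rewrite -(ler_nat R); nra.
have [sigma [us szs costly]] :=
  exists_costly_stream hU eps_gt0 finds N0.+1 en1 en2 n100.
have large : (N0 <= size sigma)%N.
  rewrite szs; apply: leq_trans (leq_pmull _ (leq_trans _ n100)) => //.
  by apply: leq_trans (ltnW (ltn_expl _ _)).
have := le_trans (stores _ us) (small _ large); rewrite szs => few.
move: costly; rewrite -(ler_nat R) !natrM => costly.
have bound_le := space_bound_le (ltn0Sn N0) en1 en2.
have : 0 < N0.+1%:R * n%:R :> R.
  by rewrite mulr_gt0 // ltr0n // (leq_trans _ n100).
by lra.
Qed.

End SpaceBound.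

Local Open Scope classical_set_scope.
Local Open Scope ring_scope.

Theorem theorem2 (R : realType) (d : Order.disp_t) (U : orderType d)
    (hU : unbounded_continuous U) :
  exists eps0 c : R, [/\ 0 < eps0, 0 < c &
    forall eps : R, 0 < eps -> eps < eps0 ->
      (~ exists (A : cb_algorithm) (s : nat -> R),
           [/\ finds_approx_median U A eps,
               stores_at_most U A s
             & s =o_\oo (space_bound eps)])
      /\
      (~ exists (A : cb_algorithm) (s : nat -> R),
           [/\ finds_approx_median U A eps,
               stores_at_most U A s
             & \forall N \near \oo, s N <= c * space_bound eps N])].
Proof.
have c_gt0 : 0 < 1 / 200 :> R by lra.
exists (1 / 100), (1 / 200); split=> [|//|eps eps_gt0 eps_small]; first by lra.
have hard := not_eventually_le_space_bound eps_gt0 hU eps_small.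
split=> -[A [s [finds stores small]]]; apply: hard finds stores _ => //.
exact: eventually_le_space_bound.
Qed.
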